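(* (1) If $\mathcal A$ is a family of subsets of $[n]$ which is a $k$-wise eventown for every $k\in\mathbb N$, then there exist pairwise disjoint even-sized subsets $B_1,\ldots,B_s$ of $[n]$ such that $\mathcal A\subseteq\{\bigcup_{i\in S}B_i : S\subseteq[s]\}$. (2) For $k\ge 2$, if $\mathcal A$ is a strong $k$-wise eventown in $[n]$ but not a $(k+1)$-wise eventown, then $|\mathcal A|\le 2^{\lfloor n/2\rfloor-(2^{k}-k-2)}$.
   Context: A family $\mathcal A=\{A_1,\ldots,A_m\}$ of distinct subsets of $[n]=\{1,\ldots,n\}$ is a $k$-wise eventown if $\left|\bigcap_{i\in S}A_i\right|$ is even for every $S\subseteq[m]$ with $|S|=k$. It is a strong $k$-wise eventown if it is a $k'$-wise eventown for every $k'\in\{1,\ldots,k\}$. *)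

(* Defs.v *)
From mathcomp Require Import all_boot all_order all_algebra.

Set Implicit Arguments.
Unset Strict Implicit.
Unset Printing Implicit Defensive.

(* The ground set [n] is 'I_n.  A family of distinct subsets is a set of sets,
   so index sets S of size k correspond to subfamilies F of cardinality k.
   The notion is only meant for k > 0; for k = 0 the empty intersection
   would be all of [n]. *)
Definition kwise_eventown (n k : nat) (A : {set {set 'I_n}}) : Prop :=
  forall F : {set {set 'I_n}},
    F \subset A -> #|F| = k -> ~~ odd #|\bigcap_(X in F) X|.

Definition strong_kwise_eventown (n k : nat) (A : {set {set 'I_n}}) : Prop :=
  forall k' : nat, 1 <= k' <= k -> kwise_eventown k' A.

(* Main.v *)
Require Import Defs.
From mathcomp Require Import all_boot all_order all_algebra.
From mathcomp Require Import mxabelem.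
From mathcomp Require Import zify.

Set Implicit Arguments.
Unset Strict Implicit.
Unset Printing Implicit Defensive.

Import Order.TTheory GRing.Theory Num.Theory.

(* (1) The blocks are the atoms, inside the union of the family, of the Boolean
   algebra that it generates: an atom is a meet of members minus a union of
   members, so inclusion-exclusion makes its size even.
   (2) Take distinct members a_0, ..., a_k of the family with odd intersection
   and the 2 (2^k - k - 2) meets a_S with 2 <= |S| <= k - 1.  Over F_2, the
   indicator vectors of the family span a self-orthogonal space V that is also
   orthogonal to every a_S, while <a_S, a_T> = 1 exactly when S and T cover
   {0, ..., k}.  This Gram matrix is invertible, so
   dim V + (dim V + 2 (2^k - k - 2)) <= n, and the family has at most 2^(dim V)
   members. *)

(** * Atoms of the Boolean algebra generated by the family *)

Section Atoms.
Variables (n : nat) (A : {set {set 'I_n}}).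
Hypothesis evenA : forall k : nat, 1 <= k -> kwise_eventown k A.

Definition bigcap_avoiding (F : {set {set 'I_n}}) (G : seq {set 'I_n}) :=
  [set z in \bigcap_(X in F) X | all (fun Y : {set 'I_n} => z \notin Y) G].

(** Inclusion-exclusion, one avoided set at a time: membership in [Y] splits the set for [F] and [G]
    into those for [Y |: F], [G] and for [F], [Y :: G]. The first two are even by induction, hence
    so is the third. *)
Lemma even_bigcap_avoiding (G : seq {set 'I_n}) (F : {set {set 'I_n}}) :
  {subset G <= A} -> F \subset A -> F != set0 ->
  ~~ odd #|bigcap_avoiding F G|.
Proof.
elim: G F => [|Y G IH] F sGA sFA F0.
  have -> : bigcap_avoiding F [::] = \bigcap_(X in F) X.
    by apply/setP=> z; rewrite inE andbT.
  by apply: (evenA (k := #|F|)) => //; rewrite card_gt0.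
have sGA' : {subset G <= A} by move=> Z ZG; apply: sGA; rewrite inE ZG orbT.
have YA : Y \in A by apply: sGA; rewrite mem_head.
have := IH F sGA' sFA F0; rewrite -(cardsID Y) oddD.
have -> : bigcap_avoiding F G :&: Y = bigcap_avoiding (Y |: F) G.
  by apply/setP=> z; rewrite /bigcap_avoiding bigcap_setU big_set1 !inE andbC andbA.
have -> : bigcap_avoiding F G :\: Y = bigcap_avoiding F (Y :: G).
  by apply/setP=> z; rewrite !inE /= andbCA.
rewrite (negPf (IH (Y |: F) sGA' _ _)) //; first by rewrite subUset sub1set YA.
by apply/set0Pn; exists Y; rewrite setU11.
Qed.

Definition atom (x : 'I_n) : {set 'I_n} :=
  [set z | [forall X in A, (z \in X) == (x \in X)]].

Lemma atomP x z :
  reflect (forall X, X \in A -> (z \in X) = (x \in X)) (z \in atom x).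
Proof.
rewrite inE; apply: (iffP forall_inP) => h X XA; first exact/eqP/h.
by rewrite h.
Qed.

Lemma even_atom x : x \in cover A -> ~~ odd #|atom x|.
Proof.
move=> /bigcupP[X0 X0A xX0].
(* The atom of [x] is the meet of the members containing [x], minus all the others; [x \in cover A]
   makes that meet nonempty. *)
have F0 : [set X in A | x \in X] != set0.
  by apply/set0Pn; exists X0; rewrite inE X0A.
have FA : [set X in A | x \in X] \subset A.
  by apply/subsetP=> X; rewrite inE => /andP[].
have GA : {subset enum [set X in A | x \notin X] <= A}.
  by move=> X; rewrite mem_enum inE => /andP[].
have := even_bigcap_avoiding GA FA F0.
congr (~~ odd #|pred_of_set _|); apply/setP=> z; rewrite inE; apply/andP/atomP.
  case=> /bigcapP hF /allP hG X XA; have [xX|xX] := boolP (x \in X).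
    by apply: hF; rewrite inE XA.
  by apply/negbTE/hG; rewrite mem_enum inE XA.
move=> h; split.
  by apply/bigcapP=> X; rewrite inE => /andP[XA]; rewrite h.
by apply/allP=> X; rewrite mem_enum inE => /andP[XA]; rewrite h.
Qed.

Lemma eventown_atoms :
   exists (s : nat) (B : 'I_s -> {set 'I_n}),
     [/\ forall i j : 'I_s, i != j -> [disjoint B i & B j],
         forall i : 'I_s, ~~ odd #|B i|
       & A \subset [set \bigcup_(i in S) B i | S : {set 'I_s}]].
Proof.
pose Q := atom @: cover A.
have QP (i : 'I_#|Q|) : exists2 x, x \in cover A & enum_val i = atom x.
  exact/imsetP/enum_valP.
exists #|Q|, (fun i => enum_val i); split.
- move=> i j; apply: contraNT => /pred0Pn[z /=]; rewrite -(inj_eq enum_val_inj).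
  have [[x _ ->] [y _ ->]] := (QP i, QP j).
  case/andP=> /atomP zx /atomP zy; apply/eqP/setP=> t.
  by apply/atomP/atomP=> h X XA; rewrite h // -?zx -?zy // ?zx ?zy.
- by move=> i; have [x xA ->] := QP i; apply: even_atom.
apply/subsetP=> X XA; apply/imsetP.
exists [set i : 'I_#|Q| | enum_val i \subset X] => //.
apply/setP=> z; apply/idP/bigcupP=> [zX|[i]]; last first.
  by rewrite inE => /subsetP; apply.
have zQ : atom z \in Q by apply: imset_f; apply/bigcupP; exists X.
exists (enum_rank_in zQ (atom z)); last by rewrite enum_rankK_in //; apply/atomP.
rewrite inE enum_rankK_in //; apply/subsetP=> t /atomP h.
by rewrite h.
Qed.

End Atoms.

(** * Indicator vectors over F_2 *)

Section Indicator.
Variable n : nat.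
Local Open Scope ring_scope.

Lemma natr_F2_eq0 m : (m%:R == 0 :> 'F_2) = ~~ odd m.
Proof. by rewrite -(dvdn_pcharf (pchar_Fp (isT : prime 2))) dvdn2. Qed.

Definition indicator (X : {set 'I_n}) : 'rV['F_2]_n := \row_j (j \in X)%:R.

Lemma indicator_inj : injective indicator.
Proof.
move=> X Y /rowP h; apply/setP=> j; have := h j; rewrite !mxE.
by do 2!case: (j \in _).
Qed.

Section Family.
Variables (I : finType) (f : I -> {set 'I_n}).

Definition indicator_mx (P : {set I}) : 'M['F_2]_(#|P|, n) :=
  \matrix_i indicator (f (enum_val i)).

Lemma card_le_rank_indicator (P : {set I}) :
  injective f -> (#|P| <= 2 ^ \rank (indicator_mx P))%N.
Proof.
move=> f_inj.
have -> : (2 ^ \rank (indicator_mx P) = #|rowg (indicator_mx P)|)%N.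
  by rewrite card_rowg card_Fp.
rewrite -[leqLHS](card_imset _ (inj_comp indicator_inj f_inj)).
apply/subset_leq_card/subsetP=> u /imsetP[x xP ->]; rewrite mem_rowg /=.
have -> : indicator (f x) = row (enum_rank_in xP x) (indicator_mx P).
  by rewrite rowK enum_rankK_in.
exact: row_sub.
Qed.

End Family.

Lemma indicator_mx_dot (I J : finType) (f : I -> {set 'I_n})
    (g : J -> {set 'I_n}) (P : {set I}) (Q : {set J}) i j :
  (indicator_mx f P *m (indicator_mx g Q)^T) i j
    = #|f (enum_val i) :&: g (enum_val j)|%:R.
Proof.
rewrite !mxE -[in RHS]sum1_card natr_sum [RHS]big_mkcond; apply: eq_bigr => t _.
by rewrite !mxE inE; do 2!case: (t \in _); rewrite ?mulr0 ?mul0r ?mulr1.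
Qed.

Lemma indicator_mx_orthogonal (I J : finType) (f : I -> {set 'I_n})
    (g : J -> {set 'I_n}) (P : {set I}) (Q : {set J}) :
  {in P & Q, forall x y, ~~ odd #|f x :&: g y|} ->
  indicator_mx f P *m (indicator_mx g Q)^T = 0.
Proof.
move=> h; apply/matrixP=> i j; rewrite indicator_mx_dot mxE; apply/eqP.
by rewrite natr_F2_eq0 h ?enum_valP.
Qed.

End Indicator.

(** * Orthogonality and the dimension bound *)

Section StrongEventown.
Local Open Scope ring_scope.

(** A vector [w *m X] in the row space of [M] is orthogonal to the rows of [X], so [w] is killed by
    the Gram matrix and vanishes. Thus [M + X] has dimension [\rank M + p], and [M] lies in its
    orthogonal complement. *)
Lemma rank_orthogonal_nondegenerate (K : fieldType) (m p n : nat)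
    (M : 'M[K]_(m, n)) (X : 'M[K]_(p, n)) :
  M *m M^T = 0 -> M *m X^T = 0 -> row_free (X *m X^T) ->
  ((\rank M).*2 + p <= n)%N.
Proof.
move=> MM MX XX.
have rX : \rank X = p.
  apply/eqP; rewrite eqn_leq rank_leq_row -{1}(eqP XX).
  exact: mxrankM_maxl.
have cap0 : (M :&: X = 0)%MS.
  apply/eqP; rewrite -submx0; apply/rV_subP=> u.
  rewrite sub_capmx => /andP[/submxP[v uM] /submxP[w uX]].
  have : w *m (X *m X^T) = 0 by rewrite mulmxA -uX uM -mulmxA MX mulmx0.
  rewrite uX -[RHS](mul0mx _ (X *m X^T)) => /(row_free_inj XX) ->.
  by rewrite mul0mx sub0mx.
have sub : (M <= kermx (M + X)%MS^T)%MS.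
  apply/sub_kermxP; apply: trmx_inj; rewrite trmx_mul trmxK trmx0.
  apply/eqP; rewrite -sub_kermx addsmx_sub !sub_kermx.
  rewrite MM eqxx /=; apply/eqP/trmx_inj.
  by rewrite trmx_mul trmxK MX trmx0.
have := mxrankS sub; rewrite mxrank_ker mxrank_tr mxrank_disjoint_sum // rX.
have := rank_leq_col (M + X)%MS; rewrite mxrank_disjoint_sum // rX.
lia.
Qed.

Variables (n k : nat) (A F : {set {set 'I_n}}).
Hypotheses (k2 : (2 <= k)%N) (evenA : strong_kwise_eventown k A).
Hypotheses (FA : F \subset A) (cardF : #|F| = k.+1).
Hypothesis oddF : odd #|\bigcap_(X in F) X|.

(** Sizes stay below [k] so that adding one member of [A] is still covered by the strong hypothesis;
    they exceed 1 so that [P] is closed under complement in [F]. *)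
Let P := [set S : {set {set 'I_n}} | (S \subset F) && (1 < #|S| < k)%N].

Let meet (S : {set {set 'I_n}}) := \bigcap_(X in S) X.

(** The subsets of [F] outside [P] have size 0, 1, [k] or [k.+1], which accounts for at most 1 +
    (k+1) + (k+1) + 1 of them. *)
Lemma card_middle_layers : (2 ^ k.+1 <= #|P| + k.*2 + 4)%N.
Proof.
pose L j := [set S : {set {set 'I_n}} | S \subset F & #|S| == j].
have cL j : #|L j| = 'C(k.+1, j) by rewrite -cardF cards_draws.
have sub : powerset F \subset P :|: (L 0%N :|: (L 1%N :|: (L k :|: L k.+1))).
  apply/subsetP=> S; rewrite !inE => SF; rewrite SF /=.
  have := subset_leq_card SF; rewrite cardF; move: #|S| => c; lia.
have U (X Y : {set {set {set 'I_n}}}) a b :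
    (#|X| <= a)%N -> (#|Y| <= b)%N -> (#|X :|: Y| <= a + b)%N.
  by rewrite cardsU => Xa Yb; rewrite (leq_trans (leq_subr _ _)) ?leq_add.
have cL' j : (#|L j| <= 'C(k.+1, j))%N by rewrite cL.
have := leq_trans (subset_leq_card sub) (U _ _ _ _ (leqnn _)
  (U _ _ _ _ (cL' _) (U _ _ _ _ (cL' _) (U _ _ _ _ (cL' _) (cL' _))))).
rewrite card_powerset cardF bin0 bin1 binn binSn; move: #|P| (2 ^ _)%N => p q.
lia.
Qed.

Let even_meet (S : {set {set 'I_n}}) :
  S \subset A -> (0 < #|S| <= k)%N -> ~~ odd #|meet S|.
Proof. by move=> SA hS; apply: (evenA hS). Qed.

Let family_selforthogonal :
  indicator_mx id A *m (indicator_mx id A)^T = 0.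
Proof.
apply: indicator_mx_orthogonal => X Y XA YA.
have -> : X :&: Y = meet [set X; Y] by rewrite /meet bigcap_setU !big_set1.
apply: even_meet; first by rewrite subUset !sub1set XA.
(* When [X = Y] the pair is a singleton, and evenness of single members is what is used. *)
by rewrite cards2; case: (X != Y); rewrite /= ?(ltnW k2).
Qed.

Let family_orthogonal_meets :
  indicator_mx id A *m (indicator_mx meet P)^T = 0.
Proof.
apply: indicator_mx_orthogonal => X S XA; rewrite inE => /and3P[SF S1 Sk].
have -> : X :&: meet S = meet (X |: S) by rewrite /meet bigcap_setU big_set1.
apply: even_meet; first by rewrite subUset sub1set XA (subset_trans SF FA).
rewrite cardsU1; move: #|S| S1 Sk => c; case: (X \in S) => /=; lia.
Qed.

(* Pairing each [S] with its complement in [F] makes the Gram matrix of the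
   meets the matrix of the inclusion order, which is unitriangular. *)
Let gram_meets_free : row_free (indicator_mx meet P *m (indicator_mx meet P)^T).
Proof.
apply: inj_row_free => v vG; apply/eqP; apply/negPn/negP => /rV0Pn[i0 vi0].
(* Take a largest set in the support of [v]: in the column of its complement, every other term of
   [v *m G] will vanish, [G] being the Gram matrix. *)
pose i := [arg max_(i > i0 | v 0%R i != 0%R) #|enum_val i|]%N.
have [vi imax] : v 0 i != 0 /\
    forall j, v 0 j != 0 -> (#|enum_val j| <= #|enum_val i|)%N.
  by rewrite /i; case: arg_maxnP.
have := enum_valP i; rewrite inE => /and3P[RF R1 Rk].
have TP : F :\: enum_val i \in P.
  rewrite inE subsetDl cardsD (setIidPr RF) cardF; move: #|_| R1 Rk => c; lia.
have /rowP/(_ (enum_rank_in TP (F :\: enum_val i))) := vG.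
rewrite mxE [RHS]mxE (bigD1 i) //= big1 => [|j ji].
  rewrite indicator_mx_dot enum_rankK_in // /meet -bigcap_setU.
  rewrite setDE setUIr setUCr setIT (setUidPr RF).
  move/eqP; rewrite addr0 mulf_eq0 (negPf vi) natr_F2_eq0 /=.
  by rewrite oddF.
have [->|vj] := eqVneq (v 0 j) 0; first by rewrite mul0r.
apply/eqP; rewrite mulf_eq0 (negPf vj) indicator_mx_dot enum_rankK_in //.
rewrite natr_F2_eq0 /meet -bigcap_setU.
have := enum_valP j; rewrite inE => /and3P[SF S1 Sk].
have UF : enum_val j :|: (F :\: enum_val i) \subset F.
  by rewrite subUset SF subsetDl.
apply: even_meet; first exact: subset_trans UF FA.
have U0 := subset_leq_card (subsetUl (enum_val j) (F :\: enum_val i)).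
rewrite (leq_trans _ U0) /= ?(ltnW S1) // -ltnS -cardF proper_card //.
(* If the union were all of [F], set [j] would contain set [i], and maximality would force
   [j = i]. *)
rewrite properE UF /=; apply: contra ji => /subsetP FU.
have RS : enum_val i \subset enum_val j.
  apply/subsetP=> X XR; have := FU X (subsetP RF X XR).
  by rewrite !inE XR /= orbF.
apply/eqP/enum_val_inj/esym/eqP; rewrite eqEcard RS; exact: imax.
Qed.

Lemma strong_eventown_rank :
  ((\rank (indicator_mx id A)).*2 + 2 ^ k.+1 <= n + k.*2 + 4)%N.
Proof.
have := rank_orthogonal_nondegenerate family_selforthogonal
  family_orthogonal_meets gram_meets_free.
have := card_middle_layers; lia.
Qed.

End StrongEventown.

Theorem theorem1p4 (n : nat) (A : {set {set 'I_n}}) :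
  ((forall k : nat, 1 <= k -> kwise_eventown k A) ->
   exists (s : nat) (B : 'I_s -> {set 'I_n}),
     [/\ forall i j : 'I_s, i != j -> [disjoint B i & B j],
         forall i : 'I_s, ~~ odd #|B i|
       & A \subset [set \bigcup_(i in S) B i | S : {set 'I_s}]])
  /\
  (forall k : nat, 2 <= k ->
   strong_kwise_eventown k A -> ~ kwise_eventown k.+1 A ->
   (#|A|%:R <= 2 ^ ((n./2)%:Z - (2 ^+ k - k%:Z - 2)) :> rat)%R).
Proof.
split; first exact: eventown_atoms.
move=> k k2 evenA notev.
have [F /and3P[FA /eqP cF oF]] : exists F : {set {set 'I_n}},
    [&& F \subset A, #|F| == k.+1 & odd #|\bigcap_(X in F) X|].
  apply/existsP; apply: contra_notT notev => /existsPn h F FA cF.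
  by have := h F; rewrite FA cF eqxx.
have rk := strong_eventown_rank k2 evenA FA cF oF.
have cA := @card_le_rank_indicator n _ id A (@inj_id _).
apply: (@le_trans _ _ (2 ^ (\rank (indicator_mx id A))%:Z)%R).
  by rewrite -exprnP -natrX ler_nat.
rewrite ler_eXz2l //.
have -> : (2 ^+ k = (2 ^ k)%N%:Z :> int)%R by rewrite -natrX natz.
(* Halving the rank bound gives the exponent; the floor comes from the rank being an integer. *)
move: rk; rewrite expnS; lia.
Qed.
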